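(* Let $k$ be a positive integer. Then there exists a finite group $G$ which is $\delta_{k+1}$-maximal, soluble of derived length $k+2$, but satisfies $\delta_{k+1}(G) \neq 1$.
   Context: The standard derived words are defined recursively by $\delta_1 := [x,y] = x^{-1}y^{-1}xy$ and $\delta_{k+1} := [\delta_k(x_1,\ldots,x_{2^k}), \delta_k(y_1,\ldots,y_{2^k})]$ for $k \geq 1$ (in independent variables). For a word $w = w(x_1,\ldots,x_n)$ and a group $G$, the verbal subgroup $w(G)$ is the subgroup generated by all values $w(g_1,\ldots,g_n)^{\pm 1}$ with $g_i \in G$. A finite group $G$ is $w$-maximal if $|G:w(G)| > |H:w(H)|$ for all proper subgroups $H$ of $G$. *)

(* Defs.v *)
From HB Require Import structures.
From mathcomp Require Import all_boot all_fingroup all_solvable.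
Set Implicit Arguments.
Unset Strict Implicit.
Unset Printing Implicit Defensive.
Import GroupScope.

(* Group words in the variables x_0, ..., x_(n-1). These are formal expressions:
   distinct expressions may denote the same element of the free group, but they
   then take the same values in every group. *)
Inductive word (n : nat) : Type :=
| WVar of 'I_n
| WMul of word n & word n
| WInv of word n.

Definition wcomm n (u v : word n) : word n :=
  WMul (WMul (WMul (WInv u) (WInv v)) u) v.

Fixpoint wrename m n (f : 'I_m -> 'I_n) (w : word m) : word n :=
  match w with
  | WVar i => WVar (f i)
  | WMul u v => WMul (wrename f u) (wrename f v)
  | WInv u => WInv (wrename f u)
  end.

Fixpoint weval (gT : finGroupType) n (g : 'I_n -> gT) (w : word n) : gT :=
  match w with
  | WVar i => g i
  | WMul u v => weval g u * weval g v
  | WInv u => (weval g u)^-1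
  end.

Lemma expn2S k : (2 ^ k + 2 ^ k = 2 ^ k.+1)%N.
Proof. by rewrite expnS mul2n addnn. Qed.

Definition lvar k (i : 'I_(2 ^ k)) : 'I_(2 ^ k.+1) :=
  cast_ord (expn2S k) (lshift (2 ^ k) i).
Definition rvar k (i : 'I_(2 ^ k)) : 'I_(2 ^ k.+1) :=
  cast_ord (expn2S k) (rshift (2 ^ k) i).

(* The recursion is started one step early, at the word x_0 in one variable, so
   that delta 1 = [x_0, x_1]; see weval_delta1. *)
Fixpoint delta (k : nat) : word (2 ^ k) :=
  match k return word (2 ^ k) with
  | 0 => WVar ord0
  | j.+1 => wcomm (wrename (@lvar j) (delta j)) (wrename (@rvar j) (delta j))
  end.

Lemma weval_wrename (gT : finGroupType) m n (f : 'I_m -> 'I_n)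
    (g : 'I_n -> gT) (w : word m) :
  weval g (wrename f w) = weval (g \o f) w.
Proof. by elim: w => //= [u -> v ->|u ->]. Qed.

Lemma weval_delta1 (gT : finGroupType) (g : 'I_(2 ^ 1) -> gT) :
  weval g (delta 1) = (g ord0)^-1 * (g ord_max)^-1 * g ord0 * g ord_max.
Proof.
rewrite /=.
have -> : @lvar 0 ord0 = ord0 by apply: val_inj.
by have -> : @rvar 0 ord0 = ord_max by apply: val_inj.
Qed.

Lemma weval_deltaS (gT : finGroupType) k (g : 'I_(2 ^ k.+1) -> gT) :
  weval g (delta k.+1) =
    [~ weval (g \o @lvar k) (delta k), weval (g \o @rvar k) (delta k)].
Proof. by rewrite /= !weval_wrename commgEl /conjg !mulgA. Qed.

Definition word_values n (w : word n) (gT : finGroupType) (G : {set gT}) :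
    {set gT} :=
  [set weval g w | g : {ffun 'I_n -> gT} in ffun_on (mem G)].

Definition verbal n (w : word n) (gT : finGroupType) (G : {set gT}) :
    {set gT} :=
  <<word_values w G :|: (word_values w G)^-1>>.

Canonical verbal_group n (w : word n) (gT : finGroupType) (G : {set gT}) :=
  [group of verbal w G].

Definition word_maximal n (w : word n) (gT : finGroupType) (G : {group gT}) :
    Prop :=
  forall H : {group gT}, H \proper G ->
    (#|H : verbal w H| < #|G : verbal w G|)%N.

Definition has_derived_length (gT : finGroupType) (G : {group gT}) (n : nat) :
    Prop :=
  G^`(n) = 1 /\ forall m, (m < n)%N -> G^`(m) <> 1.

(* Main.v *)
Require Import Defs.
From HB Require Import structures.
From mathcomp Require Import all_boot all_fingroup all_solvable.
Set Implicit Arguments.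
Unset Strict Implicit.
Unset Printing Implicit Defensive.
Import GroupScope.

(** The verbal subgroup of [delta n] is the n-th derived subgroup, so the task is
    to find a soluble group [G] whose last nontrivial derived subgroup
    [N = G^`(k.+1)] is so hard to avoid that [|H : H^`(k.+1)| < |G : N|] for
    every proper subgroup [H].

    Suppose that [N] has order 2. Then [H^`(k.+1)] is [N] or 1. If it is [N], the
    inequality is [|H| < |G|]. If it is 1, the inequality is [|H| < |G| / 2], that
    is, [H] has index greater than 2. So it is enough that every subgroup of
    index 2 has the same (k+1)-st derived subgroup as [G].

    Such a [G] is a central product [K1 \* K2 \* K3] of three copies of one group
    [K] with [|K^`(k.+1)| = 2], in which the three subgroups [Ki^`(k.+1)] are
    identified. Let [H] have index 2 in [G]. If [H] contains [K2] or [K3], then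
    [H^`(k.+1)] contains [N]. Otherwise, given [a] and [a'] in [K1],
    there are [b] in [K2] and [c] in [K3] with [a * b] and [a' * c] in [H], because
    an element of [Ki] outside [H] corrects the class modulo [H]. The factors
    commute with each other, so [[~ a * b, a' * c] = [~ a, a']]: two independent
    correcting factors leave no trace in the commutator. Hence [K1^`(1)] lies
    in [H^`(1)], and [N = K1^`(k.+1)] lies in [H^`(k.+1)]
    ([der_index2_central_triple]).

    The group [K] comes from 2-groups of large derived length, namely iterated
    wreath products with a group of order 2: the derived subgroup of [P wr 2]
    meets the base group [P * P] in a subgroup that projects onto [P]
    ([der_wreath2]). In such a 2-group the (k+1)-st derived subgroup has a
    subgroup of index 2 that is normal in the whole group, and dividing by it
    gives [K] ([der_order2]). *)

(** * Verbal subgroups of the derived words *)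

Section WordValues.
Variable gT : finGroupType.
Implicit Types (G : {group gT}) (x y : gT).

Lemma eq_weval n (g h : 'I_n -> gT) (w : word n) :
  g =1 h -> weval g w = weval h w.
Proof. by move=> eq_gh; elim: w => //= [u -> v ->|u ->]. Qed.

Lemma wevalJ n (g : 'I_n -> gT) (w : word n) x :
  weval (fun i => g i ^ x) w = weval g w ^ x.
Proof. by elim: w => //= [u -> v ->|u ->]; rewrite ?conjMg ?conjVg. Qed.

Lemma mem_weval n (g : 'I_n -> gT) (w : word n) G :
  (forall i, g i \in G) -> weval g w \in G.
Proof.
by move=> Gg; elim: w => //= [u IHu v IHv|u IHu]; rewrite ?groupM ?groupV.
Qed.

Lemma word_valuesP n (w : word n) G x :
  reflect (exists2 g : 'I_n -> gT, (forall i, g i \in G) & x = weval g w)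
          (x \in word_values w G).
Proof.
apply: (iffP imsetP) => [[g /ffun_onP Gg ->]|[g Gg ->]]; first by exists g.
exists [ffun i => g i]; first by apply/ffun_onP=> i; rewrite ffunE.
by apply: eq_weval => i; rewrite ffunE.
Qed.

Lemma word_values_norm n (w : word n) G : G \subset 'N(word_values w G).
Proof.
apply/subsetP=> x Gx; rewrite inE; apply/subsetP=> _ /imsetP[y + ->].
case/word_valuesP=> g Gg ->; apply/word_valuesP.
by exists (fun i => g i ^ x) => [i|]; rewrite ?wevalJ ?groupJ.
Qed.

Lemma word_values_sub n (w : word n) G : word_values w G \subset G.
Proof. by apply/subsetP=> _ /word_valuesP[g Gg ->]; apply: mem_weval. Qed.

Lemma verbalE n (w : word n) G : verbal w G = <<word_values w G>>.
Proof.
apply/eqP; rewrite eqEsubset [X in _ && X]genS ?subsetUl // andbT.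
rewrite gen_subG subUset subset_gen /=.
by apply: subset_trans (subset_gen _) _; rewrite genV.
Qed.

(** The two halves of the variables of [delta k.+1] are independent, so any two
    values of [delta k] can be taken by them at once. *)
Lemma mem_delta_valuesS k G x y :
  x \in word_values (delta k) G -> y \in word_values (delta k) G ->
  [~ x, y] \in word_values (delta k.+1) G.
Proof.
case/word_valuesP=> g Gg -> /word_valuesP[h Gh ->]; apply/word_valuesP.
pose gh (i : 'I_(2 ^ k.+1)) :=
  match split (cast_ord (esym (expn2S k)) i) with
  | inl j => g j | inr j => h j end.
exists gh => [i|]; first by rewrite /gh; case: split.
rewrite weval_deltaS; congr [~ _, _]; apply: eq_weval => i;
  rewrite /= /gh cast_ordK.
  by rewrite (unsplitK (inl i)).
by rewrite (unsplitK (inr i)).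
Qed.

(** The values of [delta k.+1] are the commutators of values of [delta k]. They
    form a normal subset, so modulo the subgroup they generate the values of
    [delta k] commute, and therefore so do all elements of [G^`(k)]. *)
Lemma verbal_delta k G : verbal (delta k) G = G^`(k).
Proof.
rewrite verbalE; elim: k => [|k IHk].
  apply/eqP; rewrite eqEsubset gen_subG word_values_sub /=.
  apply/subsetP=> x Gx; apply/mem_gen/word_valuesP.
  by exists (fun=> x).
apply/eqP; rewrite eqEsubset dergSn -IHk gen_subG; apply/andP; split.
  apply/subsetP=> _ /word_valuesP[g Gg ->]; rewrite weval_deltaS.
  by apply: mem_commg; apply/mem_gen/word_valuesP;
    [exists (g \o @lvar k)|exists (g \o @rvar k)] => // i; apply: Gg.
have sXN : word_values (delta k) G \subset 'N(<<word_values (delta k.+1) G>>).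
  apply: subset_trans (word_values_sub _ _) _.
  exact: subset_trans (word_values_norm _ _) (norm_gen _).
rewrite -derg1 der1_min ?gen_subG //= /abelian.
rewrite quotient_gen // cent_gen gen_subG /=.
apply/centsP=> _ /morphimP[x Nx Xx ->] _ /morphimP[y Ny Xy ->].
apply/commgP; rewrite -morphR //= coset_id //.
by apply/mem_gen/mem_delta_valuesS.
Qed.

End WordValues.

(** * Derived subgroups in a central product of three groups *)

Section CentralTriple.

Variables (gT : finGroupType) (n : nat) (G N K1 K2 K3 : {group gT}).
Hypothesis defG : K1 \* K2 \* K3 = G.
Hypotheses (dK1 : K1^`(n.+1) = N) (dK2 : K2^`(n.+1) = N) (dK3 : K3^`(n.+1) = N).

Lemma der_central_triple : G^`(n.+1) = N.
Proof.
have [[K12 _ defK12 _] _ _] := cprodP defG.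
have := defG; rewrite defK12 => /(der_cprod n.+1).
rewrite -(der_cprod n.+1 defK12) dK1 dK2 dK3.
case/cprodP=> [[L _ defL _] <- _].
by rewrite defL; have [_ <- _] := cprodP defL; rewrite !mulGid.
Qed.

(** With [a] and [a'] both moved into [H] by elements of [K2], the commutator of
    these two elements would be left over. Taking one of them from [K3] makes
    them commute. *)
Lemma der_index2_central_triple (H : {group gT}) :
  H \subset G -> #|G : H| = 2 -> N \subset H^`(n.+1).
Proof.
move=> sHG iH.
have [[K12 _ defK12 _] mulG12 cK123] := cprodP defG.
have [_ mulK12 cK12] := cprodP defK12.
have sK1G : K1 \subset G.
  rewrite -mulG12 defK12; apply: subset_trans (mulG_subl K3 K12).
  by rewrite -mulK12 mulG_subl.
have sK2G : K2 \subset G.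
  rewrite -mulG12 defK12; apply: subset_trans (mulG_subl K3 K12).
  by rewrite -mulK12 mulG_subr.
have sK3G : K3 \subset G by rewrite -mulG12 defK12 mulG_subr.
rewrite defK12 -mulK12 in cK123.
have cK13 : K3 \subset 'C(K1) by rewrite (subset_trans cK123) ?centS ?mulG_subl.
have cK23 : K3 \subset 'C(K2) by rewrite (subset_trans cK123) ?centS ?mulG_subr.
have [sK2H|/subsetPn[b0 Kb0 Hb0]] := boolP (K2 \subset H).
  by rewrite -dK2 dergS.
have [sK3H|/subsetPn[c0 Kc0 Hc0]] := boolP (K3 \subset H).
  by rewrite -dK3 dergS.
(* The product of two elements outside [H] lies in [H], which has index 2. *)
have correct (L : {group gT}) d a : L \subset G -> d \in L -> d \notin H ->
    a \in K1 -> exists2 e, e \in L & a * e \in H.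
  move=> sLG Ld Hd Ka; case: (boolP (a \in H)) => Ha.
    by exists 1; rewrite ?group1 ?mulg1.
  exists d^-1; rewrite ?groupV // -mem_rcoset.
  have Gd : d \in G :\: H by rewrite inE Hd (subsetP sLG).
  by rewrite (rcoset_index2 sHG iH Gd) inE Ha (subsetP sK1G).
suffices sK1H : K1^`(1) \subset H^`(1).
  rewrite -dK1; elim: (n) => // m IHm.
  by rewrite dergSn (dergSn m.+1 H) commgSS.
rewrite !derg1 gen_subG; apply/subsetP=> _ /imset2P[a a' Ka Ka' ->].
have [b Kb Hab] := correct K2 b0 a sK2G Kb0 Hb0 Ka.
have [c Kc Hac] := correct K3 c0 a' sK3G Kc0 Hc0 Ka'.
suffices <-: [~ a * b, a' * c] = [~ a, a'] by rewrite mem_commg.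
have fixJ (x y : gT) : commute x y -> x ^ y = x.
  by move=> cxy; rewrite conjgE cxy mulKg.
rewrite commgEl conjMg.
have -> : a ^ (a' * c) = a ^ a'.
  rewrite conjgM fixJ //; apply/commute_sym/(centP (subsetP cK13 _ Kc)).
  by rewrite groupJ.
have -> : b ^ (a' * c) = b.
  apply: fixJ; apply: commuteM; first exact: centsP cK12 _ Kb _ Ka'.
  exact/commute_sym/(centsP cK23 _ Kc).
rewrite invMg -mulgA (mulgA a^-1) -commgEl -conjgE fixJ //.
by apply/commute_sym/(centP (subsetP cK12 _ Kb)); rewrite groupR.
Qed.
End CentralTriple.

Lemma central_triple_maximal (gT : finGroupType) n (G N K1 K2 K3 : {group gT}) :
    K1 \* K2 \* K3 = G -> #|N| = 2 ->
    K1^`(n.+1) = N -> K2^`(n.+1) = N -> K3^`(n.+1) = N ->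
  forall H : {group gT}, H \proper G -> #|H : H^`(n.+1)| < #|G : G^`(n.+1)|.
Proof.
move=> defG oN dK1 dK2 dK3 H prHG; have sHG := proper_sub prHG.
have dG := der_central_triple defG dK1 dK2 dK3.
have sH'N : H^`(n.+1) \subset N by rewrite -dG dergS.
have ltHG : #|H| < #|G| by apply: proper_card.
have [sNH'|] := boolP (N \subset H^`(n.+1)).
  have H'N : H^`(n.+1) = N by apply/eqP; rewrite eqEsubset sH'N.
  by rewrite -(ltn_pmul2l (cardG_gt0 N)) -{1}H'N dG !Lagrange -?dG ?der_sub.
move=> not_sNH'; have H'1 : H^`(n.+1) = 1.
  by rewrite -(setIidPr sH'N) prime_TIg ?oN.
have iH_gt1 : 1 < #|G : H| by rewrite indexg_gt1 proper_subn.
have iH_neq2 : #|G : H| != 2.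
  apply: contra not_sNH' => /eqP iH.
  exact: (der_index2_central_triple defG dK1 dK2 dK3).
rewrite H'1 indexg1 dG -(ltn_pmul2l (cardG_gt0 N)) Lagrange -?dG ?der_sub //.
rewrite -(Lagrange sHG) dG oN mulnC ltn_pmul2l ?cardG_gt0 //.
by rewrite ltn_neqAle eq_sym iH_neq2.
Qed.

(** * Groups of large derived length with a derived subgroup of order 2 *)

Lemma normal_index2_pgroup (gT : finGroupType) (G A : {group gT}) :
  2.-group G -> A <| G -> A :!=: 1 ->
  exists2 M : {group gT}, M <| G & M \subset A /\ #|A : M| = 2.
Proof.
move=> pG nAG ntA; have pA := pgroupS (normal_sub nAG) pG.
have [|M [sMA nMG oM]] := @normal_pgroup 2 gT (logn 2 #|A|).-1 _ _ pG nAG.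
  exact: leq_pred.
exists M => //; split=> //.
rewrite -divgS // oM {1}(card_pgroup pA).
have [_ _ [e ->]] := pgroup_pdiv pA ntA.
by rewrite pfactorK // expnS mulnK // expn_gt0.
Qed.

Definition wreath2 (gT : Type) : Type := (gT * gT * bool)%type.

Section Wreath.
Variable gT : finGroupType.
Local Notation W := (wreath2 gT).
HB.instance Definition _ := Finite.copy W (gT * gT * bool)%type.

(** The boolean component is the element of the top group: when it is [true] in
    the left factor, it swaps the coordinates of the right factor. *)
Definition wreath2_mul (u v : W) : W :=
  let: (a, b, e) := u in let: (c, d, f) := v in
  (if e then (a * d, b * c) else (a * c, b * d), e (+) f).
Definition wreath2_inv (u : W) : W :=
  let: (a, b, e) := u in (if e then (b^-1, a^-1) else (a^-1, b^-1), e).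

Lemma wreath2_mulA : associative wreath2_mul.
Proof.
by move=> [[a b] []] [[c d] []] [[f g] []]; rewrite /wreath2_mul !mulgA.
Qed.
Lemma wreath2_mul1 : left_id (1, 1, false) wreath2_mul.
Proof. by move=> [[a b] e]; rewrite /wreath2_mul !mul1g. Qed.
Lemma wreath2_mulV : left_inverse (1, 1, false) wreath2_inv wreath2_mul.
Proof. by move=> [[a b] []]; rewrite /= !mulVg. Qed.

HB.instance Definition _ :=
  Finite_isGroup.Build W wreath2_mulA wreath2_mul1 wreath2_mulV.

Lemma card_wreath2 : #|[set: W]| = (#|gT| * #|gT| * 2)%N.
Proof. by rewrite cardsT !card_prod card_bool. Qed.

Definition wreath2_base : {set W} := [set u | ~~ u.2].
Lemma wreath2_base_group_set : group_set wreath2_base.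
Proof.
apply/group_setP; split=> [|[[a b] e] [[c d] f]]; rewrite !inE //=.
by case: e; case: f.
Qed.
Canonical wreath2_base_group := Group wreath2_base_group_set.

Definition wreath2_fst (u : W) : gT := u.1.1.
Lemma wreath2_fstM : {in wreath2_base &, {morph wreath2_fst : u v / u * v}}.
Proof. by move=> [[a b] e] [[c d] f]; rewrite !inE /=; case: e. Qed.
Canonical wreath2_fst_morphism := Morphism wreath2_fstM.

(** Commuting [(x^-1, 1)] with the swap gives [(x, x^-1)], an element of the base
    group with arbitrary first coordinate. So the derived subgroup of the wreath
    product has a section isomorphic to the whole of [gT]. *)
Lemma der_wreath2 n : [set: gT]^`(n) != 1 -> [set: W]^`(n.+1) != 1.
Proof.
pose J := ([set: W]^`(1) :&: wreath2_base)%G.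
have im_J : wreath2_fst @* J = [set: gT].
  apply/eqP; rewrite eqEsubset subsetT; apply/subsetP=> x _.
  pose u : W := ((x^-1, 1), false); pose s : W := ((1, 1), true).
  have us : [~ u, s] = ((x, x^-1), false).
    rewrite commgEl conjgE.
    have -> : s^-1 = s by congr (_, _, _); exact: invg1.
    have -> : u * s = ((x^-1, 1), true) by congr (_, _, _); exact: mulg1.
    have -> : s * ((x^-1, 1), true) = ((1, x^-1), false).
      by congr (_, _, _); exact: mul1g.
    by congr (_, _, _); rewrite ?invgK ?mulg1 ?invg1 ?mul1g.
  have W'us : [~ u, s] \in [set: W]^`(1) by rewrite mem_commg ?inE.
  rewrite us in W'us; apply/morphimP; exists ((x, x^-1), false) => //.
    by rewrite inE.
  by rewrite inE W'us inE.
apply: contraNneq => dW1.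
have sJ : J^`(n) \subset [set: W]^`(n.+1).
  have sJ1: J \subset [set: W]^`(1) by apply: subsetIl.
  by elim: (n) => // m IHm; rewrite dergSn (dergSn m.+1) commgSS.
rewrite -im_J -morphim_der ?subsetIr //.
by rewrite dW1 subG1 in sJ; rewrite (eqP sJ) morphim1.
Qed.
End Wreath.

Lemma pgroup_der_neq1 n : exists gT : finGroupType,
  2.-group [set: gT] /\ [set: gT]^`(n) != 1.
Proof.
elim: n => [|n [gT [pG ntG]]].
  exists bool; split; first by rewrite /pgroup cardsT card_bool.
  by apply/trivgPn; exists true.
exists (wreath2 gT); split; last exact: der_wreath2.
by rewrite /pgroup card_wreath2 !pnatM -!cardsT [pnat _ _]pG.
Qed.

(** In a finite p-group every normal subgroup contains normal subgroups of all
    the orders that its own order allows, so the n-th derived subgroup of a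
    2-group can be cut down to order 2 by passing to a quotient. *)
Lemma der_order2 n : exists (gT : finGroupType), #|[set: gT]^`(n)| = 2.
Proof.
have [gT [pG ntG]] := pgroup_der_neq1 n.
have [M nMG [sMA iM]] := normal_index2_pgroup pG (der_normal n _) ntG.
exists (coset_of M).
have -> : [set: coset_of M] = [set: gT] / M.
  apply/setP=> u; rewrite inE; have [x Nx ->] := cosetP u.
  by rewrite mem_quotient ?inE.
rewrite -quotient_der ?normal_norm // card_quotient //.
exact: subset_trans (der_sub _ _) (normal_norm nMG).
Qed.

(** Conjugation permutes [N] and fixes 1, so it fixes the only other element. *)
Lemma card2_normal_central (gT : finGroupType) (G N : {group gT}) :
  N <| G -> #|N| = 2 -> N \subset 'Z(G).
Proof.
move=> nNG oN; rewrite subsetI normal_sub // centsC.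
have /cards1P[z defN] : #|N^#| == 1%N.
  by have := cardsD1 1 N; rewrite group1 oN add1n => -[<-].
apply/centsP=> g Gg x Nx; have [->|x1] := eqVneq x 1; first exact: commute1.
have Nx1 : x \in N^# by rewrite !inE x1.
have : x ^ g \in N^#.
  by rewrite memJ_norm // (subsetP _ _ Gg) // normD1 normal_norm.
rewrite defN => /set1P xg; apply/commute_sym/commgP/conjg_fixP.
by rewrite xg; apply/esym/set1P; rewrite -defN.
Qed.

(** * Central product of three copies of a group over a central subgroup *)

Section CentralCube.
Variables (T : finGroupType) (N : {group T}).
Hypothesis cN : N \subset 'Z([set: T]).
Local Notation T3 := (T * T * T)%type.

(** The kernel of the product map from [N * N * N] to [N]: dividing by it
    identifies the three copies of [N] and leaves each of them intact. *)
Definition antidiag : {set T3} :=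
  [set u | [&& u.1.1 \in N, u.1.2 \in N, u.2 \in N
            & u.1.1 * u.1.2 * u.2 == 1]].

Let cNT x y : x \in N -> commute y x.
Proof.
move=> Nx; apply/commute_sym; have /centerP[_] := subsetP cN _ Nx.
by apply; rewrite inE.
Qed.

Lemma antidiag_group_set : group_set antidiag.
Proof.
apply/group_setP; split=> [|[[a b] c] [[a' b'] c']].
  by rewrite !inE /= !group1 !mulg1 eqxx.
rewrite !inE /= => /and4P[Na Nb Nc /eqP abc] /and4P[Na' Nb' Nc' /eqP abc'].
rewrite !groupM //=; apply/eqP; rewrite -[RHS]mulg1 -{1}abc -abc' !mulgA.
rewrite -(mulgA _ b' c) -(cNT c Nb') mulgA -(mulgA a a') -(cNT b Na') mulgA.
by rewrite -(mulgA _ a' c) -(cNT c Na') mulgA.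
Qed.
Canonical antidiag_group := Group antidiag_group_set.

Lemma antidiag_normal : [set: T3] \subset 'N(antidiag).
Proof.
apply: cents_norm; rewrite centsC; apply/centsP=> [[[a b] c]].
rewrite inE /= => /and4P[Na Nb Nc _] [[x y] z] _.
by congr (_, _, _); apply/commute_sym/cNT.
Qed.

(** The index is a variable so that the three embeddings, which differ only in
    the coordinate they fill, can be treated at once. *)
Definition copy3 (i : 'I_3) (x : T) : coset_of antidiag :=
  coset antidiag
   (if i == 0 :> nat then x else 1,
    if i == 1%N :> nat then x else 1,
    if i == 2 :> nat then x else 1).

Lemma copy3M i : {in [set: T] &, {morph copy3 i : x y / x * y}}.
Proof.
move=> x y _ _; rewrite -morphM ?(subsetP antidiag_normal) ?inE //.
by congr (coset _ (_, _, _)); case: eqP; rewrite ?mulg1.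
Qed.
Canonical copy3_morphism i := Morphism (@copy3M i).

Lemma copy3_comm i j x y : i != j -> commute (copy3 i x) (copy3 j y).
Proof.
move=> neq_ij; rewrite /commute /copy3.
rewrite -!morphM ?(subsetP antidiag_normal) ?inE //.
have comm1 k :
    (if i == k :> nat then x else 1) * (if j == k :> nat then y else 1)
  = (if j == k :> nat then y else 1) * (if i == k :> nat then x else 1).
  case: eqP => [ik|_]; last by rewrite mulg1 mul1g.
  case: eqP => [jk|_]; last by rewrite mulg1 mul1g.
  by case/eqP: neq_ij; apply: val_inj; rewrite /= ik jk.
by congr (coset _ (_, _, _)); apply: comm1.
Qed.

Lemma copy3_eq i x : x \in N -> copy3 i x = copy3 ord0 x.
Proof.
move=> Nx; have Nx1 : x^-1 \in N by rewrite groupV.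
have [->//|i0] := eqVneq i ord0.
(* The triple with [x] in coordinate [i] and the one with [x] in coordinate 0
   differ by the triple with [x^-1] in coordinate 0 and [x] in coordinate [i]. *)
rewrite -[RHS](@coset_kerl _ antidiag
   (x^-1, if i == 1%N :> nat then x else 1,
    if i == 2 :> nat then x else 1)).
  congr (coset _ _); case: i i0 => -[|[|[|]]] //= lti _.
    by congr (_, _, _); rewrite ?mulVg ?mulg1.
  by congr (_, _, _); rewrite ?mulVg ?mulg1.
rewrite inE /=; case: i i0 => -[|[|[|]]] //= lti _;
  by rewrite Nx Nx1 group1 ?mulg1 mulVg eqxx.
Qed.

Lemma copy3_1 x : copy3 ord0 x = 1 -> x = 1.
Proof.
move/coset_idr=> /(_ (subsetP antidiag_normal _ (in_setT _))).
by rewrite inE /= !mulg1 => /and4P[_ _ _ /eqP].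
Qed.

Lemma morphim_copy3 i : copy3 i @* N = copy3 ord0 @* N.
Proof.
rewrite !morphimEsub ?subsetT //.
apply: eq_in_imset => x Nx; exact: copy3_eq.
Qed.

Lemma card_morphim_copy3 : #|copy3 ord0 @* N| = #|N|.
Proof.
rewrite card_injm ?subsetT //; apply/subsetP=> x.
move=> /morphpreP[_ /set1P/copy3_1 ->].
exact: set11.
Qed.
End CentralCube.

Lemma central_triple_exists (T : finGroupType) n : #|[set: T]^`(n)| = 2 ->
  exists (gT : finGroupType) (G N K1 K2 K3 : {group gT}),
    [/\ K1 \* K2 \* K3 = G, #|N| = 2,
        K1^`(n) = N, K2^`(n) = N & K3^`(n) = N].
Proof.
move=> oN; have cN := card2_normal_central (der_normal n [set: T]%G) oN.
pose f := copy3_morphism cN; pose K i := (f i @* [set: T])%G.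
have cK i j : i != j -> K j \subset 'C(K i).
  move=> neq_ij; apply/centsP=> _ /morphimP[x _ _ ->] _ /morphimP[y _ _ ->].
  by apply: (copy3_comm cN); rewrite eq_sym.
have dK i : (K i)^`(n) = f ord0 @* ([set: T]^`(n)).
  by rewrite -morphim_der ?subsetT // morphim_copy3.
pose k1 : 'I_3 := ord0; pose k2 : 'I_3 := inord 1; pose k3 : 'I_3 := inord 2.
have c12 : k1 != k2 by rewrite -val_eqE /= inordK.
have c13 : k1 != k3 by rewrite -val_eqE /= inordK.
have c23 : k2 != k3 by rewrite -val_eqE /= !inordK.
exists (coset_of (antidiag_group cN)), (K k1 <*> K k2 <*> K k3)%G.
exists (f ord0 @* ([set: T]^`(n)))%G, (K k1), (K k2), (K k3).
split=> //; last by rewrite /= card_morphim_copy3.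
rewrite (cprodEY (cK _ _ c12)) /= cprodEY // centY subsetI.
by rewrite !cK.
Qed.

Theorem theorem5p3 (k : nat) (hk : (0 < k)%N) :
  exists (gT : finGroupType) (G : {group gT}),
    [/\ word_maximal (delta k.+1) G,
        solvable G,
        has_derived_length G k.+2
      & verbal (delta k.+1) G <> 1].
Proof.
have [T oN] := der_order2 k.+1.
have [gT [G [N [K1 [K2 [K3 [defG oN' dK1 dK2 dK3]]]]]]] :=
  central_triple_exists oN.
have dG := der_central_triple defG dK1 dK2 dK3.
have ntG : G^`(k.+1) <> 1 by move=> G1; rewrite -dG G1 cards1 in oN'.
have dG1 : G^`(k.+2) = 1.
  rewrite dergSn dG; apply/commG1P/cyclic_abelian.
  by rewrite prime_cyclic ?oN'.
exists gT, G; split; rewrite ?verbal_delta //.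
- move=> H prHG; rewrite !verbal_delta.
  by apply: central_triple_maximal prHG; eassumption.
- by apply/derivedP; exists k.+2.
split=> // m; rewrite ltnS => le_mk Gm1; apply: ntG; apply/trivgP.
rewrite -Gm1; elim: {hk oN dK1 dK2 dK3 dG dG1} (k.+1) le_mk => [|j IHj].
  by rewrite leqn0 => /eqP->.
rewrite leq_eqVlt ltnS => /predU1P[->//|/IHj].
exact: subset_trans (der_subS _ _).
Qed.
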